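(* Let $G=(V,E)$ be a locally finite weighted graph satisfying the $CD\psi(n,-K)$ condition with $K\geq 0$, where $\psi\in C^{1}(0,+\infty)$ is a concave function. Let $b>\frac12$ be a constant. Then for any bounded function $f\in\ell^\infty(V)$ with $f>0$ everywhere, and any $t>0$, the following holds pointwise on $V$: $$\Gamma^\psi(P_tf)\leq \psi'(1)\left(1+\frac{2Kt}{2b+1}\right)\frac{\Delta P_tf}{P_tf}+\frac n2\left(\frac{b^2}{(2b-1)t}+\frac{K^2t}{2b+1}+K\right).$$
   Context: A locally finite weighted graph $G=(V,E)$ here means a connected graph in which every vertex has finitely many neighbours, with a vertex measure $\mu:V\to(0,\infty)$ and symmetric edge weights $w_{xy}=w_{yx}>0$ for $x\sim y$ (adjacent), such that $D_\mu:=\sup_{x}\frac{\deg(x)}{\mu(x)}<\infty$ where $\deg(x)=\sum_{y\sim x}w_{xy}$, $\mu_{\max}:=\sup_x\mu(x)<\infty$, and $w_{\min}:=\inf_{x\sim y}w_{xy}>0$. For $f:V\to\mathbb R$, $\Delta f(x)=\frac1{\mu(x)}\sum_{y\sim x}w_{xy}(f(y)-f(x))$. $\Delta$ is bounded on $\ell^\infty(V)$ (bounded functions, sup norm), and $P_t=e^{t\Delta}=\sum_{k\ge0}\frac{t^k}{k!}\Delta^k$, $t\ge0$. For $\psi\in C^1(0,\infty)$ and $f:V\to(0,\infty)$: $(\Delta^\psi f)(x)=\Delta\left[\psi\left(\frac{f}{f(x)}\right)\right](x)$. For concave $\psi$ put $\overline\psi(s)=\psi'(1)(s-1)-[\psi(s)-\psi(1)]$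 and $\Gamma^\psi(f):=\Delta^{\overline\psi}f$, i.e. $\Gamma^\psi(f)(x)=\frac1{\mu(x)}\sum_{y\sim x}w_{xy}\overline\psi\left(\frac{f(y)}{f(x)}\right)$. Further $$\Omega^\psi f(x)=\Delta\left[\psi'\left(\frac f{f(x)}\right)\frac f{f(x)}\left(\frac{\Delta f}{f}-\frac{\Delta f(x)}{f(x)}\right)\right](x),$$ $$2\Gamma_2^\psi(f)=\Omega^\psi(f)+\frac{\Delta f\cdot\Delta^\psi f}{f}-\frac{\Delta(f\cdot\Delta^\psi f)}{f}.$$ For $n>0$ and $\kappa\in\mathbb R$, $G$ satisfies $CD\psi(n,\kappa)$ if for every $f:V\to(0,\infty)$, pointwise on $V$, $\Gamma_2^\psi(f)\ge\frac1n(\Delta^\psi f)^2+\kappa\,\Gamma^\psi(f)$. *)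

(* Defs.v *)
From mathcomp Require Import all_boot all_order all_algebra.
From mathcomp Require Import all_classical all_reals all_analysis.

Set Implicit Arguments.
Unset Strict Implicit.
Unset Printing Implicit Defensive.

Import Order.TTheory GRing.Theory Num.Theory.
Import numFieldNormedType.Exports.

Local Open Scope classical_set_scope.
Local Open Scope ring_scope.

(* [weight x y] is meaningful only when [adj x y].  Self-loops are not
   excluded: they contribute to [degree] but to none of the operators below. *)
Record wgraph (R : realType) := WGraph {
  vertex :> choiceType;
  adj : rel vertex;
  weight : vertex -> vertex -> R;
  measure : vertex -> R;
  adj_sym : symmetric adj;
  adj_connected : forall x y, exists p, path adj x p /\ last x p = y;
  adj_locally_finite : forall x, finite_set [set y | adj x y];
  weight_sym : forall x y, adj x y -> weight x y = weight y x;
  weight_gt0 : forall x y, adj x y -> 0 < weight x y;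
  measure_gt0 : forall x, 0 < measure x
}.

Section Geometry.
Variables (R : realType) (G : wgraph R).

Definition degree (x : G) : R := \sum_(y \in [set y | adj x y]) weight x y.

Definition D_mu : \bar R :=
  ereal_sup [set (degree x / measure x)%:E | x in [set: G]].

Definition mu_max : \bar R := ereal_sup [set (measure x)%:E | x in [set: G]].

(* +oo when there is no edge *)
Definition w_min : \bar R :=
  ereal_inf [set (weight e.1 e.2)%:E | e in [set e : G * G | adj e.1 e.2]].

End Geometry.

Section Operators.
Variables (R : realType) (G : wgraph R).
Implicit Types (f : G -> R) (psi : R -> R) (x : G).

Definition lap f x : R :=
  (measure x)^-1 * \sum_(y \in [set y | adj x y]) (weight x y * (f y - f x)).

(* The exponential series is summed pointwise; by [heat_cvg] below this is also
   its sum in the operator norm of l^oo(G). *)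
Definition heat_series (t : R) f x : R^nat :=
  [series t ^+ k / k`!%:R * iter k lap f x]_k.

Definition heat (t : R) f x : R := limn (heat_series t f x).

Definition lap_psi psi f x : R := lap (fun y => psi (f y / f x)) x.

Definition psi_bar psi (s : R) : R :=
  derive1 psi 1 * (s - 1) - (psi s - psi 1).

Definition Gamma_psi psi f x : R := lap_psi (psi_bar psi) f x.

Definition Omega_psi psi f x : R :=
  lap (fun y => derive1 psi (f y / f x) * (f y / f x)
                * (lap f y / f y - lap f x / f x)) x.

Definition Gamma2_psi psi f x : R :=
  2^-1 * (Omega_psi psi f x
          + lap f x * lap_psi psi f x / f x
          - lap (fun y => f y * lap_psi psi f y) x / f x).

Definition CDpsi psi (n kappa : R) : Prop :=
  forall f, (forall x, 0 < f x) ->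
  forall x, n^-1 * lap_psi psi f x ^+ 2 + kappa * Gamma_psi psi f x
            <= Gamma2_psi psi f x.

End Operators.

(* Only the values of [psi] on ]0, +oo[ matter. *)
Definition C1_pos (R : realType) (psi : R -> R) : Prop :=
  (forall s, 0 < s -> derivable psi s 1) /\
  (forall s, 0 < s -> {for s, continuous (derive1 psi : R -> R)}).

Definition concave_pos (R : realType) (psi : R -> R) : Prop :=
  convex_function (`]0, +oo[%classic : set R) (fun s => - psi s).

Section HeatConvergence.
Variables (R : realType) (G : wgraph R).
Hypothesis D_fin : (D_mu G < +oo)%E.
Let D := fine (D_mu G).

Let degree_le (x : G) : (measure x)^-1 * degree x <= D.
Proof.
have le_D : ((degree x / measure x)%:E <= D_mu G)%E.
  by apply: ereal_sup_ubound; exists x.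
rewrite mulrC -lee_fin /D fineK// fin_numElt D_fin andbT.
by rewrite (lt_le_trans _ le_D) ?ltNyr.
Qed.

Lemma lap_bound (f : G -> R) (M : R) : (forall x, `|f x| <= M) ->
  forall x, `|lap f x| <= 2 * D * M.
Proof.
move=> fM x; have M0 : 0 <= M := le_trans (normr_ge0 _) (fM x).
have m0 : 0 <= (measure x)^-1 by rewrite invr_ge0 ltW// measure_gt0.
have fin := adj_locally_finite x.
rewrite /lap normrM (ger0_norm m0).
apply: (@le_trans _ _ ((measure x)^-1 * degree x * (2 * M))); last first.
  by rewrite [leRHS]mulrAC [leRHS]mulrC ler_wpM2r ?mulr_ge0// degree_le.
rewrite -mulrA ler_wpM2l//.
rewrite /degree !fsbig_finite// big_distrl/=.
apply: le_trans (ler_norm_sum _ _ _) _.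
rewrite big_seq [leRHS]big_seq; apply: ler_sum => y.
rewrite in_fset_set// inE /= => xy.
have w0 : 0 <= weight x y by rewrite ltW// weight_gt0.
rewrite normrM (ger0_norm w0) ler_wpM2l//.
by rewrite (le_trans (ler_normB _ _))// mulr_natl mulr2n lerD.
Qed.

Let iter_lap_bound (f : G -> R) (M : R) k : (forall x, `|f x| <= M) ->
  forall x, `|iter k (@lap R G) f x| <= (2 * D) ^+ k * M.
Proof.
move=> fM; elim: k => [x|k IH x]; first by rewrite expr0 mul1r.
by rewrite iterS exprS -mulrA; exact: lap_bound.
Qed.

Lemma heat_cvg (t : R) : 0 <= t -> forall e : R, 0 < e ->
  \forall N \near \oo, forall (f : G -> R) (M : R), (forall x, `|f x| <= M) ->
  forall x, `|heat t f x - heat_series t f x N| <= e * M.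
Proof.
move=> t0 e e0; pose v := exp_coeff (t * `|2 * D|).
have v0 k : 0 <= v k by rewrite exp_coeff_ge0// mulr_ge0.
have cv : cvgn (series v) := is_cvg_series_exp_coeff _.
have nv : nondecreasing_seq (series v) by exact: nondecreasing_series.
have /cvgrPdist_le/(_ _ e0) := cv.
apply: filterS => N VN f M fM x.
have M0 : 0 <= M := le_trans (normr_ge0 _) (fM x).
pose a k := t ^+ k / k`!%:R * iter k (@lap R G) f x.
have av k : `|a k| <= M * v k.
  rewrite /a normrM ger0_norm ?divr_ge0 ?exprn_ge0//.
  have c0 : 0 <= t ^+ k / k`!%:R by rewrite divr_ge0 ?exprn_ge0.
  apply: le_trans (ler_wpM2l c0 (iter_lap_bound k fM x)) _.
  rewrite mulrA mulrC ler_wpM2l// /v /exp_coeff/= [(t * _) ^+ k]exprMn mulrAC.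
  rewrite ler_wpM2r ?invr_ge0 ?ler0n// ler_wpM2l ?exprn_ge0//.
  by rewrite -normrX ler_norm.
have ca : cvgn (series a).
  apply: (@normed_cvg _ R^o); apply: series_le_cvg av _ => [k|k|].
  - exact: normr_ge0.
  - by rewrite mulr_ge0.
  - exact: (@is_cvg_seriesZ _ _ M cv).
have dist m : (N <= m)%N ->
    `|series a m - series a N| <= M * (series v m - series v N).
  move=> Nm; rewrite !sub_series_geq// mulr_sumr.
  by rewrite (le_trans (ler_norm_sum _ _ _))// ler_sum.
have cd : (fun m => `|series a m - series a N|) @ \oo -->
    `|heat t f x - heat_series t f x N|.
  by apply: cvg_norm; apply: cvgB; [exact: ca | exact: cvg_cst].
rewrite -(cvg_lim _ cd)//; apply: limr_le; first by apply/cvg_ex; eexists; exact: cd.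
exists N => // m /= Nm; rewrite (le_trans (dist m Nm))// mulrC ler_wpM2r//.
rewrite (le_trans _ VN)// (le_trans _ (ler_norm _))// lerB//.
exact: nondecreasing_cvgn_le.
Qed.

End HeatConvergence.

(* Main.v *)
Require Import Defs.
From mathcomp Require Import all_boot all_order all_algebra.
From mathcomp Require Import all_classical all_reals all_analysis.
From mathcomp Require Import finmap ring lra.

Set Implicit Arguments.
Unset Strict Implicit.
Unset Printing Implicit Defensive.

Import Order.TTheory GRing.Theory Num.Theory.
Import numFieldNormedType.Exports.

Local Open Scope classical_set_scope.
Local Open Scope ring_scope.

(* With [u = P_t f], Gamma^psi(u) = psi'(1) Delta u / u - Delta^psi u, and the
   term Omega^psi in Gamma_2^psi is the time derivative of Delta^psi u, so that
   CDpsi(n, -K) is a differential inequality for [g = - u Delta^psi u]: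
     d/dt g <= Delta g - (2 / n) g^2 / u + 2 K g + 2 K psi'(1) Delta u.
   As [u] and [Delta u] solve the heat equation, completing the square makes
     t^(2b) (g - c(t) u - a(t) psi'(1) Delta u)
   a subsolution, where [c] and [a] are the coefficients of the statement.
   A comparison principle shows that it is nonpositive.

   The comparison principle needs bounded functions, whereas [psi] may be
   unbounded near 0 and the ratios [u y / u x] need not be bounded even for
   adjacent [x] and [y].  Hence the inequality is first proved for
   [f >= e > 0], and then applied to [f + e], since P_t (f + e) = P_t f + e. *)

(* [measure] is hidden by the measures of MathComp-Analysis. *)
Local Notation measure := Defs.measure.

(** * Linearity, limits, derivatives and a one-sided bound for the Laplacian *)

Section Laplacian.
Variables (R : realType) (G : wgraph R).
Implicit Types (f g : G -> R) (x y : G).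

Lemma lapE f x : lap f x =
  (measure x)^-1 *
    \sum_(y <- fset_set [set y | adj x y]) weight x y * (f y - f x).
Proof. by rewrite /lap fsbig_finite//; exact: adj_locally_finite. Qed.

Lemma eq_lap f g : f =1 g -> lap f =1 lap g.
Proof. by move=> /funext ->. Qed.

Lemma lapZ (c : R) f x : lap (fun y => c * f y) x = c * lap f x.
Proof.
rewrite !lapE [RHS]mulrCA; congr (_ * _); rewrite mulr_sumr.
by apply: eq_bigr => y _; rewrite -mulrBr mulrCA.
Qed.

Lemma lapD f g x : lap (fun y => f y + g y) x = lap f x + lap g x.
Proof.
rewrite !lapE -mulrDr -big_split/=; congr (_ * _).
by apply: eq_bigr => y _; rewrite -mulrDr opprD addrACA.
Qed.

Lemma lapN f x : lap (fun y => - f y) x = - lap f x.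
Proof. by rewrite -mulN1r -lapZ; apply: eq_lap => y; rewrite mulN1r. Qed.

Lemma lapB f g x : lap (fun y => f y - g y) x = lap f x - lap g x.
Proof. by rewrite lapD lapN. Qed.

Lemma lapDc f (c : R) : lap (fun y => f y + c) = lap f.
Proof.
apply/funext => x; rewrite !lapE; congr (_ * _).
by apply: eq_bigr => y _; rewrite opprD addrACA subrr addr0.
Qed.

Lemma lap_cst (c : R) x : lap (fun=> c) x = 0.
Proof. by rewrite lapE big1 ?mulr0// => y _; rewrite subrr mulr0. Qed.

(** Local finiteness makes [lap] a finite sum at each vertex, so pointwise convergence suffices,
    without uniformity over [G]. *)
Lemma cvg_lap T (F : set_system T) {FF : Filter F} (u : T -> G -> R) f x :
  (forall y, u s y @[s --> F] --> f y) ->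
  lap (u s) x @[s --> F] --> lap f x.
Proof.
move=> uf; under eq_cvg do rewrite lapE.
rewrite lapE; apply: cvgMr; apply: cvg_big => [|y _].
  exact: add_continuous.
by apply: cvgMr; apply: cvgB; exact: uf.
Qed.

Lemma is_derive_lap (u : R -> G -> R) (u' : G -> R) (s : R) x :
  (forall y, is_derive s 1 (u ^~ y) (u' y)) ->
  is_derive s 1 (fun r => lap (u r) x) (lap u' x).
Proof.
move=> du; under eq_fun do rewrite lapE.
rewrite lapE; set e := fset_set _.
have dsum : is_derive s 1 (fun r => \sum_(y <- e) weight x y * (u r y - u r x))
    (\sum_(y <- e) weight x y * (u' y - u' x)).
  elim: (e : seq G) => [|y e0 IH].
    by under eq_fun do rewrite big_nil; rewrite big_nil; exact: is_derive_cst.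
  under eq_fun do rewrite big_cons.
  rewrite big_cons.
  exact: (is_deriveD (is_deriveZ (weight x y) (is_deriveB (du y) (du x))) IH).
exact: (is_deriveZ (measure x)^-1 dsum).
Qed.

Hypothesis D_fin : (D_mu G < +oo)%E.
Let D := fine (D_mu G).

Lemma degree_le x : (measure x)^-1 * degree x <= D.
Proof.
have le_D : ((degree x / measure x)%:E <= D_mu G)%E.
  by apply: ereal_sup_ubound; exists x.
rewrite mulrC -lee_fin /D fineK// fin_numElt D_fin andbT.
by rewrite (lt_le_trans _ le_D) ?ltNyr.
Qed.

(** The norm bound [lap_bound] for the constant function 1 reads [0 <= 2 * D]. *)
Lemma D_mu_ge0 x : 0 <= D.
Proof.
have := lap_bound D_fin (f := cst 1) (M := 1) _ x.
rewrite mulr1 => h; suff : 0 <= 2 * D by rewrite pmulr_rge0.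
by apply: le_trans (h _) => // y; rewrite normr1.
Qed.

(** Each increment [f y - f x] is at most [M - f x], which is nonnegative. This is the maximum
    principle behind [heat_comparison] and [heat_gt0]. *)
Lemma lap_le_max f (M : R) x : (forall y, f y <= M) ->
  lap f x <= D * (M - f x).
Proof.
move=> fM; have m0 : 0 <= (measure x)^-1.
  by rewrite invr_ge0 ltW// Defs.measure_gt0.
apply: (@le_trans _ _ ((measure x)^-1 * degree x * (M - f x))); last first.
  by rewrite ler_wpM2r ?degree_le// subr_ge0.
rewrite -mulrA lapE ler_wpM2l//.
rewrite /degree fsbig_finite; last exact: adj_locally_finite.
rewrite big_distrl/= big_seq [leRHS]big_seq; apply: ler_sum => y.
rewrite in_fset_set; last exact: adj_locally_finite.
move=> /set_mem/= xy.
by rewrite ler_wpM2l ?lerD2r// ltW// weight_gt0.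
Qed.

End Laplacian.

(** * Calculus in one real variable *)

Lemma is_derive_ext (R : realType) (f g : R -> R) (s df dg : R) :
  is_derive s 1 f df -> f = g -> df = dg -> is_derive s 1 g dg.
Proof. by move=> ? <- <-. Qed.

Lemma is_derive_le0_nincr (R : realType) (f df : R -> R) (a b : R) :
  a <= b -> (forall s, a <= s <= b -> is_derive s 1 f (df s)) ->
  (forall s, a <= s <= b -> df s <= 0) -> f b <= f a.
Proof.
move=> ab fdf df0.
have cf : {within `[a, b], continuous f}.
  apply: derivable_within_continuous => s; rewrite in_itv/= => /fdf.
  by case.
have [|c] := @MVT_segment R f df a b ab _ cf.
  move=> s; rewrite in_itv/= => /andP[/ltW as_ /ltW sb].
  by apply: fdf; rewrite as_.
rewrite in_itv/= => /df0 dc0 fab.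
by rewrite -subr_le0 fab mulr_le0_ge0// subr_ge0.
Qed.

(** * The heat semigroup: differentiation in time, comparison and positivity *)

Section HeatSemigroup.
Variables (R : realType) (G : wgraph R).
Hypothesis D_fin : (D_mu G < +oo)%E.
Let D := fine (D_mu G).
Implicit Types (f : G -> R) (x y : G).

Lemma heat_series_cvg (t : R) f (M : R) x : 0 <= t -> (forall y, `|f y| <= M) ->
  heat_series t f x @ \oo --> heat t f x.
Proof.
move=> t0 fM; have M0 : 0 <= M := le_trans (normr_ge0 _) (fM x).
(* [M] may be 0, so the tolerance is divided by [M + 1]. *)
have M1 : 0 < M + 1 by rewrite ltr_wpDl.
apply/cvgrPdist_le => e e0.
have := heat_cvg D_fin t0 (divr_gt0 e0 M1).
apply: filterS => n /(_ f M fM x) /le_trans; apply.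
by rewrite mulrAC ler_pdivrMr// ler_wpM2l ?lerDl// ltW.
Qed.

Lemma heat0 f : heat 0 f =1 f.
Proof.
move=> x; rewrite /heat; apply: cvg_lim => //.
(* At time 0 every nonempty partial sum reduces to its term [k = 0], as [0 ^+ 0 = 1]; the empty sum
   at index 0 is skipped. *)
apply: cvg_near_cst; exists 1%N => // -[//|n] _.
rewrite /heat_series /series/= big_nat_recl//= big1 ?addr0.
  by rewrite expr0 fact0 divr1 mul1r.
by move=> k _; rewrite exprS !mul0r.
Qed.

Lemma lap_heat_series (t : R) f n x :
  lap (fun y => heat_series t f y n) x = heat_series t (lap f) x n.
Proof.
elim: n => [|n IH].
  have s0 g y : heat_series t g y 0 = 0 * g y.
    by rewrite /heat_series /series/= big_geq// mul0r.
  by under eq_fun do rewrite s0; rewrite lapZ s0.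
rewrite /heat_series in IH *; under eq_fun do rewrite seriesSr.
by rewrite lapD IH lapZ -iterS iterSr seriesSr.
Qed.

Lemma lap_heat (t : R) f (M : R) x : 0 <= t -> (forall y, `|f y| <= M) ->
  lap (heat t f) x = heat t (lap f) x.
Proof.
move=> t0 fM; apply/esym; rewrite /heat; apply: cvg_lim => //.
under eq_cvg do rewrite -lap_heat_series.
by apply: (@cvg_lap _ _ _ _ _ (fun n y => heat_series t f y n)) => y;
  exact: heat_series_cvg fM.
Qed.

(** For fixed [x], [heat] is a power series in time, and differentiating it termwise shifts its
    coefficients to those of [lap f]. The criterion asks that the series of [f], [lap f] and
    [lap (lap f)] converge at a point beyond [|t|], here [|t| + 1]. *)
Lemma is_derive_heat (t : R) f (M : R) x : (forall y, `|f y| <= M) ->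
  is_derive t 1 (fun s => heat s f x) (heat t (lap f) x).
Proof.
move=> fM.
pose c f k : R := iter k (@lap R G) f x / k`!%:R.
have cE g : (fun s => heat s g x) = (fun s => limn (pseries (c g) s)).
  apply/funext => s; congr (limn (series _)); apply/funext => k.
  by rewrite /c [RHS]mulrC mulrA mulrAC.
have dE g : pseries_diffs (c g) = c (lap g).
  apply/funext => k; rewrite /pseries_diffs /c -iterSr factS natrM invfM.
  by rewrite mulrCA mulVKf.
have cv g (N : R) : (forall y, `|g y| <= N) -> cvgn (pseries (c g) (`|t| + 1)).
  move=> gN; have t0 : 0 <= `|t| + 1 by rewrite addr_ge0.
  suff -> : pseries (c g) (`|t| + 1) = heat_series (`|t| + 1) g x.
    exact: cvgP (heat_series_cvg t0 gN).
  congr series; apply/funext => k.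
  by rewrite /c [LHS]mulrC mulrA mulrAC.
rewrite cE; have -> : heat t (lap f) x = limn (pseries (pseries_diffs (c f)) t).
  by rewrite dE; exact: (congr1 (@^~ t) (cE (lap f))).
apply: (@pseries_snd_diffs _ _ (`|t| + 1)); rewrite ?dE.
- exact: cv fM.
- exact: cv (lap_bound D_fin fM).
- exact: cv (lap_bound D_fin (lap_bound D_fin fM)).
- by rewrite [ltRHS]ger0_norm ?addr_ge0// ltrDl.
Qed.

Lemma iter_lap_bound f (M : R) k : (forall x, `|f x| <= M) ->
  forall x, `|iter k (@lap R G) f x| <= (2 * D) ^+ k * M.
Proof.
move=> fM; elim: k => [x|k IH x]; first by rewrite expr0 mul1r.
by rewrite iterS exprS -mulrA; exact: lap_bound.
Qed.

(** Termwise domination by the series of [expR (t * (2 * D))]. The bound is crude, but it provides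
    the a priori constant [C] of [heat_comparison]. *)
Lemma heat_bound (t : R) f (M : R) x : 0 <= t -> (forall y, `|f y| <= M) ->
  `|heat t f x| <= M * expR (t * (2 * D)).
Proof.
move=> t0 fM; have M0 : 0 <= M := le_trans (normr_ge0 _) (fM x).
have D0 : 0 <= D by exact: D_mu_ge0.
have cv : `|heat_series t f x n| @[n --> \oo] --> `|heat t f x|.
  by apply: cvg_norm; exact: heat_series_cvg fM.
rewrite -(cvg_lim _ cv)//; apply: limr_le.
  by apply/cvg_ex; eexists; exact: cv.
near=> n.
have : series (exp_coeff (t * (2 * D))) n <= expR (t * (2 * D)).
  apply: nondecreasing_cvgn_le; last exact: is_cvg_series_exp_coeff.
  by apply: nondecreasing_series => k _ _; rewrite exp_coeff_ge0// !mulr_ge0.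
move=> /(ler_wpM2l M0); apply: le_trans.
apply: (le_trans (ler_norm_sum _ _ _)).
rewrite mulr_sumr ler_sum// => k _.
have c0 : 0 <= t ^+ k / k`!%:R by rewrite divr_ge0 ?exprn_ge0.
rewrite normrM (ger0_norm c0) /exp_coeff/= exprMn.
rewrite (le_trans (ler_wpM2l c0 (iter_lap_bound k fM x)))//.
by rewrite le_eqVlt; apply/orP; left; apply/eqP; ring.
Unshelve. all: by end_near. Qed.

(** The Laplacian kills constants, so [c] enters only the term [k = 0]. *)
Lemma heatDc (t : R) f (M c : R) x : 0 <= t -> (forall y, `|f y| <= M) ->
  heat t (fun y => f y + c) x = heat t f x + c.
Proof.
move=> t0 fM.
rewrite {1}/heat; apply: cvg_lim => //.
have cv : heat_series t f x n + c @[n --> \oo] --> heat t f x + c.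
  by apply: cvgD; [exact: heat_series_cvg fM|exact: cvg_cst].
apply: cvg_trans cv; apply: near_eq_cvg; exists 1%N => // -[//|n] _ /=.
rewrite /heat_series /series/= !big_nat_recl//= expr0 fact0 divr1 !mul1r.
rewrite addrAC; congr (_ + _ + _).
by apply: eq_bigr => k _; rewrite -!iterS !iterSr lapDc.
Qed.

(* If [W <= C], then [d/ds (expR (D s) (W - C)) <= 0], so that [W <= C q] with
   [q = 1 - expR (- D (T - a)) < 1]; iterating gives [W <= 0]. *)
Lemma heat_comparison (W W' : R -> G -> R) (a T C : R) :
  (forall s x, a <= s <= T -> is_derive s 1 (W ^~ x) (W' s x)) ->
  (forall s x, a <= s <= T -> W' s x <= lap (W s) x) ->
  (forall s x, a <= s <= T -> W s x <= C) ->
  (forall x, W a x <= 0) ->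
  forall s x, a <= s <= T -> W s x <= 0.
Proof.
move=> dW W'le WC Wa s x sT.
have D0 : 0 <= D := D_mu_ge0 D_fin x.
pose q := 1 - expR (- (D * (T - a))).
have aT : a <= T by case/andP: sT; exact: le_trans.
have q0 : 0 <= q by rewrite subr_ge0 expR_le1 oppr_le0 mulr_ge0// subr_ge0.
have q1 : q < 1 by rewrite gtrBl expR_gt0.
(* [C] may be negative; the iteration needs a nonnegative bound. *)
pose B := Num.max C 0.
have B0 : 0 <= B by rewrite le_max lexx orbT.
have step k : forall r y, a <= r <= T -> W r y <= B * q ^+ k.
  elim: k => [r y rT|k IH r y /andP[ar rT]].
    by rewrite mulr1 le_max WC.
  set E := B * q ^+ k in IH.
  have E0 : 0 <= E by rewrite mulr_ge0// exprn_ge0.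
  pose v r := expR (D * (r - a)) * (W r y - E).
  have : v r <= v a.
    apply: (@is_derive_le0_nincr _ _ (fun r =>
      expR (D * (r - a)) * (D * (W r y - E) + W' r y))) => //.
      move=> r' /andP[ar' r'r].
      have r'T : a <= r' <= T by rewrite ar' (le_trans r'r).
      have d1 : is_derive r' 1 (fun r => expR (D * (r - a)))
          (expR (D * (r' - a)) * D).
        apply: (@is_derive1_comp _ expR (fun r => D * (r - a))).
        apply: is_derive_ext (is_deriveZ D
          (is_deriveB (is_derive_id r' 1) (is_derive_cst a r' 1))) _ _ => //.
        by rewrite subr0 [_ *: _]mulr1.
      have d2 : is_derive r' 1 (fun r => W r y - E) (W' r' y).
        apply: is_derive_ext
          (is_deriveB (dW r' y r'T) (is_derive_cst E r' 1)) _ _ => //.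
        by rewrite subr0.
      apply: is_derive_ext (is_deriveM d1 d2) _ _ => //.
      by rewrite /GRing.scale/=; ring.
    move=> r' /andP[ar' r'r].
    have r'T : a <= r' <= T by rewrite ar' (le_trans r'r).
    rewrite mulr_ge0_le0 ?expR_ge0//.
    (* Since [W r' <= E] everywhere, [W' <= lap W <= D (E - W)], so the derivative of [v] is
       nonpositive. *)
    have := lap_le_max D_fin y (IH r' ^~ r'T).
    have := W'le r' y r'T; rewrite -/D; nra.
  rewrite /v subrr mulr0 expR0 mul1r => vr.
  have {}vr : W r y - E <= - (E * expR (- (D * (r - a)))).
    rewrite -(ler_pM2l (expR_gt0 (D * (r - a)))) mulrN mulrCA -expRD subrr.
    rewrite expR0 mulr1.
    by rewrite (le_trans vr)// -[leRHS]add0r lerD2r.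
  have er : expR (- (D * (T - a))) <= expR (- (D * (r - a))).
    by rewrite ler_expR lerN2 ler_wpM2l// lerD2r.
  (* The gain is smallest at [r = T], which yields one factor [q] valid on the whole interval. *)
  have -> : B * q ^+ k.+1 = E - E * expR (- (D * (T - a))).
    by rewrite exprSr mulrA -/E mulrBr mulr1.
  have := ler_wpM2l E0 er; lra.
have cv : B * q ^+ k @[k --> \oo] --> 0.
  by apply: cvg_geometric; rewrite ger0_norm.
rewrite -(cvg_lim _ cv)//; apply: limr_ge; first by apply/cvg_ex; exists 0.
by near=> k; exact: step.
Unshelve. all: by end_near. Qed.

(** Comparison applied to [e - heat s f], which solves the heat equation and is nonpositive at time
    0. *)
Lemma heat_ge (t : R) f (M e : R) x : 0 <= t -> (forall y, `|f y| <= M) ->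
  (forall y, e <= f y) -> e <= heat t f x.
Proof.
move=> t0 fM ef; rewrite -subr_le0.
apply: (@heat_comparison (fun s y => e - heat s f y)
  (fun s y => - heat s (lap f) y) 0 t
  (`|e| + M * expR (t * (2 * D)))); rewrite ?t0 ?lexx//.
- move=> s y st.
  apply: is_derive_ext (is_deriveB (is_derive_cst e s 1)
    (@is_derive_heat s f M y fM)) _ _ => //.
  by rewrite sub0r.
- move=> s y /andP[s0 st].
  by rewrite lapB lap_cst (lap_heat _ s0 fM) sub0r.
- move=> s y /andP[s0 st].
  rewrite (le_trans (ler_norm _))// (le_trans (ler_normB _ _))// lerD2l.
  apply: (le_trans (heat_bound _ s0 fM)).
  have M0 : 0 <= M := le_trans (normr_ge0 _) (fM x).
  by rewrite ler_wpM2l// ler_expR ler_wpM2r// mulr_ge0// (D_mu_ge0 D_fin x).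
- by move=> y; rewrite heat0 subr_le0.
Qed.

Lemma heat_le (t : R) f (M e : R) x : 0 <= t -> (forall y, `|f y| <= M) ->
  (forall y, f y <= e) -> heat t f x <= e.
Proof.
move=> t0 fM fe; rewrite -subr_le0.
apply: (@heat_comparison (fun s y => heat s f y - e)
  (fun s y => heat s (lap f) y) 0 t
  (`|e| + M * expR (t * (2 * D)))); rewrite ?t0 ?lexx//.
- move=> s y st.
  apply: is_derive_ext (is_deriveB (@is_derive_heat s f M y fM)
    (is_derive_cst e s 1)) _ _ => //.
  by rewrite subr0.
- by move=> s y /andP[s0 st]; rewrite lapB lap_cst (lap_heat _ s0 fM) subr0.
- move=> s y /andP[s0 st].
  rewrite (le_trans (ler_norm _))// (le_trans (ler_normB _ _))// addrC lerD2l.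
  apply: (le_trans (heat_bound _ s0 fM)).
  have M0 : 0 <= M := le_trans (normr_ge0 _) (fM x).
  by rewrite ler_wpM2l// ler_expR ler_wpM2r// mulr_ge0// (D_mu_ge0 D_fin x).
- by move=> y; rewrite heat0 subr_le0.


Qed.

(** The infimum of [f] may be 0, so [heat_ge] gives only nonnegativity. From it, [lap u >= - D u]
    for [u = heat s f], hence [expR (D * s) * u] is nondecreasing in [s] and stays above [f x]. *)
Lemma heat_gt0 (t : R) f (M : R) x : 0 <= t -> (forall y, `|f y| <= M) ->
  (forall y, 0 < f y) -> 0 < heat t f x.
Proof.
move=> t0 fM f0.
have u0 s y : 0 <= s -> 0 <= heat s f y.
  by move=> s0; apply: heat_ge fM _ => // z; exact: ltW.
have : - (expR (D * t) * heat t f x) <= - (expR (D * 0) * heat 0 f x).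
  apply: (@is_derive_le0_nincr _ (fun s => - (expR (D * s) * heat s f x))
    (fun s => - (expR (D * s) * (D * heat s f x + heat s (lap f) x)))) => //.
    move=> s _.
    have d1 : is_derive s 1 (fun r => expR (D * r)) (expR (D * s) * D).
      apply: (@is_derive1_comp _ expR (fun r => D * r)).
      apply: is_derive_ext (is_deriveZ D (is_derive_id s 1)) _ _ => //.
      by rewrite [_ *: _]mulr1.
    apply: is_derive_ext (is_deriveN (is_deriveM d1
      (@is_derive_heat s f M x fM))) _ _ => //.
    by rewrite /GRing.scale/=; ring.
  move=> s /andP[s0 _]; rewrite oppr_le0 mulr_ge0 ?expR_ge0//.
  rewrite -(lap_heat _ s0 fM).
  have := @lap_le_max _ _ D_fin (fun y => - 1 * heat s f y) 0 x.
  rewrite lapZ -/D => h.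
  have : forall y, -1 * heat s f y <= 0 by move=> y; rewrite mulN1r oppr_le0 u0.
  by move=> /h; lra.
rewrite lerN2 mulr0 expR0 mul1r heat0 => h.
by rewrite -(pmulr_rgt0 _ (expR_gt0 (D * t))) (lt_le_trans (f0 x)).
Qed.

End HeatSemigroup.

(** * Algebraic identities and a compactness bound for [psi] *)

Lemma Gamma_psiE (R : realType) (G : wgraph R) (psi : R -> R) (f : G -> R) x :
  f x != 0 ->
  Gamma_psi psi f x = derive1 psi 1 * (lap f x / f x) - lap_psi psi f x.
Proof.
move=> fx0; rewrite /Gamma_psi /lap_psi.
have -> : (fun y => psi_bar psi (f y / f x)) =
    (fun y => (derive1 psi 1 / f x * f y - psi (f y / f x))
              + (psi 1 - derive1 psi 1)).
  by apply/funext => y; rewrite /psi_bar; ring.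
by rewrite lapDc lapB lapZ mulrAC -mulrA.
Qed.

(* The difference of the two sides is
   [2 / n * u * (L + n / 2 * (b / s + K)) ^+ 2]. *)
Lemma completed_square (R : realFieldType) (n K b s p u Lu L : R) :
  0 < n -> 2^-1 < b -> 0 < s -> 0 < u ->
  2 * b / s * (- (u * L)
    - n / 2 * (b ^+ 2 / ((2 * b - 1) * s) + K ^+ 2 * s / (2 * b + 1) + K) * u
    - p * (2 * K * s / (2 * b + 1)) * Lu)
  - n / 2 * (- (b ^+ 2 / ((2 * b - 1) * s ^+ 2)) + K ^+ 2 / (2 * b + 1)) * u
  - p * (2 * K / (2 * b + 1)) * Lu
  <= 2 * u * (n^-1 * L ^+ 2) + 2 * K * (u * L - p * Lu).
Proof.
move=> n0 b0 s0 u0; rewrite -subr_ge0.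
have b1 : 2 * b - 1 != 0 by rewrite gt_eqF//; lra.
have b2 : 2 * b + 1 != 0 by rewrite gt_eqF//; lra.
have [n1 s1] : n != 0 /\ s != 0 by rewrite !gt_eqF.
rewrite [leRHS](_ : _ = 2 / n * u * (L + n / 2 * (b / s + K)) ^+ 2).
  by rewrite mulr_ge0 ?sqr_ge0// mulr_ge0 ?divr_ge0// ltW.
by field; rewrite n1 s1 b1 b2.
Qed.

Lemma C1_pos_bounded (R : realType) (psi : R -> R) (a b : R) :
  C1_pos psi -> 0 < a -> a <= b ->
  exists N : R, forall s, a <= s <= b -> `|psi s| <= N.
Proof.
move=> [dpsi _] a0 ab.
have cpsi : {within `[a, b], continuous psi}.
  apply: derivable_within_continuous => s; rewrite in_itv/= => /andP[as_ _].
  by apply: dpsi; exact: lt_le_trans as_.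
have [c1 _ h1] := EVT_max ab cpsi.
have [c2 _ h2] := EVT_min ab cpsi.
exists (`|psi c1| + `|psi c2|) => s sab.
have := h1 s; have := h2 s; rewrite in_itv/= sab => /(_ isT) l2 /(_ isT) l1.
rewrite ler_norml; apply/andP; split.
  have := ler_norm (- psi c2); rewrite normrN; have := normr_ge0 (psi c1); lra.
have := ler_norm (psi c1); have := normr_ge0 (psi c2); lra.
Qed.

(** * The estimate for initial data bounded below by a positive constant *)

Section Estimate.
Variables (R : realType) (G : wgraph R).
Hypothesis D_fin : (D_mu G < +oo)%E.
Let D := fine (D_mu G).
Variables (psi : R -> R) (psi_C1 : C1_pos psi).

(** With [u = heat s f], the ratio [u y / u x] has time derivative [(u y / u x) * (lap u y / u y -
    lap u x / u x)]; the chain rule then produces the function inside [Omega_psi]. *)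
Lemma is_derive_lap_psi_heat (f : G -> R) (M s : R) x : 0 <= s ->
  (forall y, `|f y| <= M) -> (forall y, 0 < f y) ->
  is_derive s 1 (fun r => lap_psi psi (heat r f) x)
    (Omega_psi psi (heat s f) x).
Proof.
move=> s0 fM f0; have u0 y : heat s f y != 0.
  by rewrite gt_eqF// (heat_gt0 D_fin _ s0 fM).
have up y : 0 < heat s f y by exact: (heat_gt0 D_fin _ s0 fM).
apply: is_derive_lap => y.
have du z : is_derive s 1 (fun r => heat r f z) (lap (heat s f) z).
  rewrite (lap_heat D_fin _ s0 fM).
  exact: (@is_derive_heat _ _ D_fin s f M z fM).
have dpsi : is_derive (heat s f y / heat s f x) 1 psi
    (derive1 psi (heat s f y / heat s f x)).
  by rewrite derive1E; apply/derivableP/psi_C1.1; rewrite divr_gt0.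
have dV := is_deriveV (f := fun r => heat r f x) (u0 x) (du x).
have dq := is_deriveM (du y) dV.
have dc := is_derive1_comp (f := psi)
  (g := fun r => heat r f y / heat r f x) dpsi dq.
apply: is_derive_ext dc _ _ => //.
by rewrite /GRing.scale/=; field; rewrite !u0.
Qed.

Variables (n K b : R).
Hypotheses (n_gt0 : 0 < n) (K_ge0 : 0 <= K) (b_gt : 2^-1 < b).
Hypothesis cd : CDpsi G psi n (- K).

Let c (s : R) : R :=
  n / 2 * (b ^+ 2 / ((2 * b - 1) * s) + K ^+ 2 * s / (2 * b + 1) + K).
Let a (s : R) : R := 2 * K * s / (2 * b + 1).

Lemma Gamma_psi_heat_le_lower_bounded (f : G -> R) (e M t : R) x :
  0 < e -> (forall y, e <= f y) -> (forall y, `|f y| <= M) -> 0 < t ->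
  Gamma_psi psi (heat t f) x <=
    derive1 psi 1 * (1 + a t) * (lap (heat t f) x / heat t f x) + c t.
Proof.
move=> e0 ef fM t0; pose p : R := derive1 psi 1; rewrite -/p.
have f0 y : 0 < f y by exact: lt_le_trans (ef y).
have eM : e <= M by apply: le_trans (ef x) (le_trans (ler_norm _) (fM x)).
have M0 : 0 < M by exact: lt_le_trans eM.
have D0 : 0 <= D := D_mu_ge0 D_fin x.
have b1 : 0 < 2 * b - 1 by move: b_gt; lra.
have b2 : 0 < 2 * b + 1 by move: b_gt; lra.
pose u (s : R) := heat s f.
have ue (s : R) y : 0 <= s -> e <= u s y.
  by move=> s0; exact: (heat_ge D_fin _ s0 fM).
have u0 (s : R) y : 0 <= s -> 0 < u s y by move=> /(ue _ y); exact: lt_le_trans.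
have uM (s : R) y : 0 <= s -> u s y <= M.
  move=> s0; apply: (heat_le D_fin _ s0 fM) => z.
  exact: le_trans (ler_norm _) (fM z).
(* As [e <= u <= M], all ratios [u z / u y] lie in this compact interval of positive numbers. *)
have [N psiN] : exists N : R, forall s, e / M <= s <= M / e -> `|psi s| <= N.
  apply: C1_pos_bounded => //; first exact: divr_gt0.
  by rewrite ler_pdivlMr// mulrAC ler_pdivrMr// ler_pM// ltW.
have LN (s : R) y : 0 <= s -> `|lap_psi psi (u s) y| <= 2 * D * N.
  move=> s0; apply: (lap_bound D_fin) => z; apply: psiN.
  by rewrite !ler_pM ?invr_ge0 ?(ltW e0) ?(ltW M0) ?(ltW (u0 _ _ s0)) ?lef_pV2
    ?posrE ?u0 ?ue ?uM.
have N0 : 0 <= 2 * D * N by exact: le_trans (normr_ge0 _) (LN 0 x (lexx _)).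
have LuM (s : R) y : 0 <= s -> `|lap (u s) y| <= 2 * D * M.
  move=> s0; apply: (lap_bound D_fin) => z.
  by rewrite ger0_norm ?uM// ltW// u0.
have du (s : R) y : 0 <= s -> is_derive s 1 (u ^~ y) (lap (u s) y).
  move=> s0; rewrite (lap_heat D_fin _ s0 fM).
  exact: (@is_derive_heat _ _ D_fin s f M y fM).
have dLu (s : R) y : 0 <= s ->
    is_derive s 1 (fun r => lap (u r) y) (lap (lap (u s)) y).
  by move=> s0; apply: is_derive_lap => z; exact: du.
have dc (s : R) : 0 < s -> is_derive s 1 c
  (n / 2 * (- (b ^+ 2 / ((2 * b - 1) * s ^+ 2)) + K ^+ 2 / (2 * b + 1))).
  move=> s0; have s1 : s != 0 by rewrite gt_eqF.
  have d1 := is_deriveV (f := id) s1 (is_derive_id s 1).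
  have d2 := is_deriveD (is_deriveD (is_deriveZ (b ^+ 2 / (2 * b - 1)) d1)
    (is_deriveZ (K ^+ 2 / (2 * b + 1)) (is_derive_id s 1)))
    (is_derive_cst K s 1).
  apply: is_derive_ext (is_deriveZ (n / 2) d2) _ _.
    apply/funext => r; change (n / 2 * (b ^+ 2 / (2 * b - 1) * r^-1
      + K ^+ 2 / (2 * b + 1) * r + K) = c r).
    by rewrite /c invfM; ring.
  rewrite /GRing.scale/=; field.
  by rewrite s1 !gt_eqF.
have da (s : R) : is_derive s 1 a (2 * K / (2 * b + 1)).
  apply: is_derive_ext
    (is_deriveZ (2 * K / (2 * b + 1)) (is_derive_id s 1)) _ _.
    apply/funext => r; change (2 * K / (2 * b + 1) * r = a r).
    by rewrite /a mulrAC.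
  by rewrite /GRing.scale/= mulr1.
pose F (s : R) y : R :=
  - (u s y * lap_psi psi (u s) y) - c s * u s y - p * a s * lap (u s) y.
pose F' (s : R) y : R :=
  - (u s y * Omega_psi psi (u s) y + lap_psi psi (u s) y * lap (u s) y)
  - (c s * lap (u s) y + u s y *
     (n / 2 * (- (b ^+ 2 / ((2 * b - 1) * s ^+ 2)) + K ^+ 2 / (2 * b + 1))))
  - p * (a s * lap (lap (u s)) y + lap (u s) y * (2 * K / (2 * b + 1))).
have dF (s : R) y : 0 < s -> is_derive s 1 (F ^~ y) (F' s y).
  move=> s0; have s0' := ltW s0.
  have d1 := is_deriveM (du s y s0') (is_derive_lap_psi_heat y s0' fM f0).
  have d2 := is_deriveM (dc s s0) (du s y s0').
  have d3 := is_deriveM (da s) (dLu s y s0').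
  apply: is_derive_ext (is_deriveB (is_deriveB (is_deriveN d1) d2)
    (is_deriveZ p d3)) _ _ => //.
  apply/funext => r; change (- (u r y * lap_psi psi (u r) y) - c r * u r y
    - p * (a r * lap (u r) y) = F r y).
  by rewrite mulrA.
(* [c s] blows up as [s] tends to 0, but [- c s * u] is nonpositive, so [F] is still bounded above
   uniformly on []0, t]]. *)
pose B := M * (2 * D * N) + `|p| * a t * (2 * D * M).
have a_ge0 r : 0 <= r -> 0 <= a r.
  by move=> r0; rewrite /a divr_ge0 ?mulr_ge0 ?(ltW b2).
have B0 : 0 <= B.
  have M0' := ltW M0.
  apply: addr_ge0; first exact: mulr_ge0.
  apply: mulr_ge0; last by rewrite !mulr_ge0.
  by apply: mulr_ge0 => //; exact/a_ge0/ltW.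
have FB (s : R) y : 0 < s <= t -> F s y <= B.
  move=> /andP[s0 st]; have s0' := ltW s0.
  have cu : 0 <= c s * u s y.
    rewrite mulr_ge0 ?(ltW (u0 _ _ s0'))// /c mulr_ge0 ?divr_ge0 ?(ltW n_gt0)//.
    have [b1w b2w] := (ltW b1, ltW b2).
    by rewrite !addr_ge0 ?divr_ge0 ?sqr_ge0 ?mulr_ge0.
  have h1 : - (u s y * lap_psi psi (u s) y) <= M * (2 * D * N).
    rewrite (le_trans (ler_norm _))// normrN normrM ler_pM// ?LN//.
    by rewrite gtr0_norm ?uM ?u0.
  have h2 : - (p * a s * lap (u s) y) <= `|p| * a t * (2 * D * M).
    rewrite (le_trans (ler_norm _))// normrN normrM ler_pM// ?LuM//.
    rewrite normrM ler_wpM2l// ger0_norm ?a_ge0// /a.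
    by rewrite ler_wpM2r ?invr_ge0 ?(ltW b2)// ler_wpM2l// mulr_ge0.
  by rewrite /F /B; lra.
(* The curvature condition is multiplied by [u s y] and added twice to [completed_square]; the terms
   in [lap (lap u)] cancel. *)
have evol (s : R) y : 0 < s -> 2 * b / s * F s y + F' s y <= lap (F s) y.
  move=> s0; have s0' := ltW s0.
  have uy := u0 s y s0'; have uy1 : u s y != 0 by rewrite gt_eqF.
  have := cd (u0 s ^~ s0') y; rewrite (Gamma_psiE psi uy1) /Gamma2_psi -/p.
  have -> : lap (F s) y = - lap (fun z => u s z * lap_psi psi (u s) z) y
      - c s * lap (u s) y - p * a s * lap (lap (u s)) y.
    by rewrite /F !lapB lapN !lapZ.
  have := completed_square K p (lap (u s) y) (lap_psi psi (u s) y)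
    n_gt0 b_gt s0 uy.
  rewrite /F' /F -/(c s) -/(a s).
  set A := lap (fun z => u s z * _) y; set L := lap_psi _ _ _.
  set O := Omega_psi _ _ _.
  set Lu := lap (u s) y; set LLu := lap (lap _) _.
  move=> sq /(ler_wpM2l (ltW uy)).
  rewrite [leRHS](_ : _ = (u s y * O + Lu * L - A) / 2); last by field.
  rewrite [leLHS](_ : _ =
    u s y * (n^-1 * L ^+ 2) - K * (p * Lu - u s y * L)); last first.
    by field; rewrite uy1 gt_eqF.
  lra.
suff Ft : F t x <= 0.
  have ut := u0 t x (ltW t0).
  rewrite (Gamma_psiE psi (lt0r_neq0 ut)) -/p -/(u t) -(ler_pM2l ut).
  rewrite [leLHS](_ : _ =
    p * lap (u t) x - u t x * lap_psi psi (u t) x); last first.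
    by field; rewrite lt0r_neq0.
  rewrite [leRHS](_ : _ =
    p * (1 + a t) * lap (u t) x + c t * u t x); last first.
    by field; rewrite lt0r_neq0.
  by move: Ft; rewrite /F; lra.
(* The coefficient [c] is singular at 0, so comparison starts at a small time [dl > 0], with an
   arbitrary slack [d] absorbing the initial value. *)
rewrite -(pmulr_rle0 _ (powR_gt0 (2 * b) t0)); apply/ler_addgt0Pl => d d0.
rewrite addr0.
pose dl := Num.min (Num.min 1 t) (d / (B + 1)).
have dl0 : 0 < dl by rewrite !lt_min ltr01 t0 divr_gt0// ltr_wpDl.
have dlt : dl <= t by rewrite !ge_min lexx orbT.
have dl1 : dl <= 1 by rewrite !ge_min lexx.
have Bdl : B * dl <= d.
  have : dl <= d / (B + 1) by rewrite ge_min lexx orbT.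
  by rewrite ler_pdivlMr ?ltr_wpDl//; nra.
rewrite -subr_le0; apply: (@heat_comparison _ _ D_fin
  (fun s y => s `^ (2 * b) * F s y - d)
  (fun s y => s `^ (2 * b) * (2 * b / s * F s y + F' s y))
  dl t (t `^ (2 * b) * B)); rewrite ?dlt ?lexx//.
- move=> s y /andP[/(lt_le_trans dl0) s0 st].
  apply: is_derive_ext (is_deriveB (is_deriveM (is_derive1_powR (2 * b) s0)
    (dF s y s0)) (is_derive_cst d s 1)) _ _ => //.
  (* Writing [s]^ (2 * b)[as]s * s [^ (2 * b - 1)] matches the derivative of the power with the term
     [2 * b / s]. *)
  rewrite subr0 /GRing.scale/= -(mulr_powRB1 (ltW s0) (_ : 0 < 2 * b)).
    by field; rewrite gt_eqF.
  by lra.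
- move=> s y /andP[/(lt_le_trans dl0) s0 st].
  rewrite lapB lap_cst subr0 lapZ ler_wpM2l ?powR_ge0//.
  exact: evol.
- move=> s y /andP[/(lt_le_trans dl0) s0 st].
  have sp : s `^ (2 * b) <= t `^ (2 * b).
    by apply: ge0_ler_powR => //; rewrite ?nnegrE ?ltW//; lra.
  have := FB s y; rewrite s0 st => /(_ isT) /(ler_wpM2l (powR_ge0 s (2 * b))).
  have := ler_wpM2r B0 sp; lra.
- move=> y.
  have sp : dl `^ (2 * b) <= dl.
    by apply: ge1r_powR; [rewrite dl0|lra].
  have := FB dl y.
  rewrite dl0 dlt => /(_ isT) /(ler_wpM2l (powR_ge0 dl (2 * b))).
  have := ler_wpM2r B0 sp; lra.
Qed.

End Estimate.

Theorem theorem1p1 (R : realType) (G : wgraph R)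
    (D_fin : (D_mu G < +oo)%E)
    (mu_fin : (mu_max G < +oo)%E)
    (w_pos : (0 < w_min G)%E)
    (psi : R -> R) (psi_C1 : C1_pos psi) (psi_concave : concave_pos psi)
    (n K : R) (n_gt0 : 0 < n) (K_ge0 : 0 <= K)
    (cd : CDpsi G psi n (- K))
    (b : R) (b_gt : 2^-1 < b)
    (f : G -> R) (f_bounded : bounded_fun f) (f_gt0 : forall x, 0 < f x)
    (t : R) (t_gt0 : 0 < t) (x : G) :
  Gamma_psi psi (heat t f) x <=
    derive1 psi 1 * (1 + 2 * K * t / (2 * b + 1))
      * (lap (heat t f) x / heat t f x)
    + n / 2 * (b ^+ 2 / ((2 * b - 1) * t) + K ^+ 2 * t / (2 * b + 1) + K).
Proof.
(* Boundedness supplies a bound only for numbers strictly above [M0]. *)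
have [M0 [_ fM0]] := f_bounded; pose M : R := M0 + 1.
have fM y : `|f y| <= M by apply: (fM0 M) => //; rewrite ltrDl.
have t0 := ltW t_gt0.
set v := heat t f.
have v0 y : 0 < v y by exact: (heat_gt0 D_fin _ t0 fM).
have cvD y : v y + e @[e --> 0^'+] --> v y.
  rewrite -[X in _ --> X]addr0; apply: cvgD; first exact: cvg_cst.
  exact: cvg_at_right_filter cvg_id.
have cvV y : (v y + e)^-1 @[e --> 0^'+] --> (v y)^-1.
  by apply: cvgV => //; rewrite gt_eqF.
set P := derive1 psi 1 * _; set c := n / 2 * _.
(* The limit ratios [v y / v x] are positive, where [psi] is continuous. *)
have cvl : Gamma_psi psi (fun y => v y + e) x @[e --> 0^'+] -->
    Gamma_psi psi v x.
  apply: (@cvg_lap _ _ _ _ _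
    (fun e y => psi_bar psi ((v y + e) / (v x + e)))) => y.
  have q : (v y + e) / (v x + e) @[e --> 0^'+] --> v y / v x by exact: cvgM.
  have cpsi : {for (v y / v x), continuous psi}.
    apply/differentiable_continuous/derivable1_diffP/psi_C1.1.
    by rewrite divr_gt0.
  apply: cvgB; last by apply: cvgB; [exact: continuous_cvg q|exact: cvg_cst].
  by apply: cvgMr; apply: cvgB => //; exact: cvg_cst.
have cvr : P * (lap v x / (v x + e)) + c @[e --> 0^'+] -->
    P * (lap v x / v x) + c.
  by apply: cvgD; [apply: cvgMr; apply: cvgMr; exact: cvV|exact: cvg_cst].
apply: (ler_cvg_to cvl cvr); near=> e.
have e0 : 0 < e by near: e; exact: nbhs_right_gt.
have -> : (fun y => v y + e) = heat t (fun y => f y + e).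
  by apply/funext => y; rewrite (heatDc D_fin _ _ t0 fM).
have := @Gamma_psi_heat_le_lower_bounded R G D_fin psi psi_C1 n K b n_gt0 K_ge0
  (* The shift [e] itself serves as the positive lower bound of [f + e]. *)
  b_gt cd (fun y => f y + e) e (M + e) t x e0.
have -> : lap (heat t (fun y => f y + e)) x = lap v x.
  by rewrite -(lapDc v e); apply: eq_lap => y; rewrite (heatDc D_fin _ _ t0 fM).
rewrite (heatDc D_fin _ _ t0 fM); apply => //.
- by move=> y; rewrite lerDr ltW.
- by move=> y; rewrite (le_trans (ler_normD _ _))// lerD// ger0_norm// ltW.
Unshelve. all: by end_near. Qed.
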